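(* Let $R$ be a finite ring. If $\mathcal N(R)$ is not a two-sided ideal of $R[x]$, then $|R|\geq128$.
   Context: All rings are associative with identity. For a finite ring $R$, $R[x]$ is the polynomial ring in a central indeterminate $x$ (that is, $x$ commutes with the coefficients, which need not commute with each other). For $F(x)=\sum_i c_i x^i\in R[x]$ with $c_i\in R$, the right value of $F$ at $a\in R$ is $F(a)=\sum_i c_i a^i$ (coefficients written on the left of the powers). The set of null polynomials is $\mathcal N(R)=\{F\in R[x]: F(a)=0\text{ for every }a\in R\}$. It is always a left ideal of $R[x]$, but need not be a right ideal. *)

(* Defs.v *)
From mathcomp Require Import all_boot all_algebra.

Set Implicit Arguments.
Unset Strict Implicit.
Unset Printing Implicit Defensive.

Import GRing.Theory.

Local Open Scope ring_scope.

(* For a noncommutative R, [horner] puts coefficients to the left of the powers: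
   F.[a] = \sum_(i < size F) F`_i * a ^+ i (lemma [horner_coef]). It is not
   multiplicative in F. *)
Definition null_polys (R : finNzRingType) : {pred {poly R}} :=
  [pred F : {poly R} | [forall a : R, F.[a] == 0]].

Arguments null_polys R : clear implicits.

(* Unlike [idealr_closed] of ring_quotient, properness is not required, and
   absorption holds on both sides. *)
Definition two_sided_ideal (A : nzRingType) (I : {pred A}) : Prop :=
  [/\ zmod_closed I,
      forall r u : A, u \in I -> r * u \in I
    & forall r u : A, u \in I -> u * r \in I].

(* Main.v *)
(** The elements [c] such that [F c] is null for every null [F] form a subring
    containing the units, because [(F u)(b) = F(u b u^-1) u].  In a finite ring
    every element is a sum of units and of the opposite of an idempotent, so
    only idempotents [e] matter.  Put [f = 1 - e].

    If [eRf.fRe.eRf = 0 = fRe.eRf.fRe], paths in the Peirce decomposition of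
    [b ^+ i] cross between [e] and [f] at most twice, and evaluating [F] at [b]
    and at the two triangular truncations of [b] kills each part of
    [\sum_i F_i e b ^+ i].  Otherwise some [x y z] is nonzero, say with
    [x, z] in [eRf] and [y] in [fRe].  If [x y] and [y z] are nilpotent, then
    [eRe] has at least 4 elements because of [e, xy], [eRf] because of
    [z, xyz], [fRf] because of [f, yz], and [fRe] has at least 2 because of
    [y]: in all [4 * 4 * 4 * 2 = 128].  If, say, [x y] is not nilpotent, an
    idempotent power [g] of it is nonzero; since [x] and [y] square to zero, [g]
    lies in the subring generated by the units, and [e - g] is a smaller
    idempotent. *)

Require Import Defs.
From mathcomp Require Import all_boot all_algebra.

Set Implicit Arguments.
Unset Strict Implicit.
Unset Printing Implicit Defensive.

Import GRing.Theory.

Local Open Scope ring_scope.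

(** * Values of null polynomials multiplied by constants *)

Lemma null_polysP (R : finNzRingType) (F : {poly R}) :
  reflect (forall a, F.[a] = 0) (F \in null_polys R).
Proof. by apply: (iffP forallP) => H a; apply/eqP; have := H a. Qed.

Lemma horner_mulC (R : nzRingType) (F : {poly R}) (c b : R) :
  (F * c%:P).[b] = \sum_(i < size F) F`_i * (c * b ^+ i).
Proof.
rewrite (@horner_coef_wide _ (size F)).
  by apply: eq_bigr => i _; rewrite coefMC mulrA.
by apply/leq_sizeP => j le_Fj; rewrite coefMC nth_default ?mul0r.
Qed.

Lemma intertwine_exp (R : nzRingType) (a b c : R) i :
  c * b = a * c -> c * b ^+ i = a ^+ i * c.
Proof.
move=> cb; elim: i => [|i IH]; rewrite ?mulr1 ?mul1r //.
by rewrite exprSr mulrA IH -mulrA cb mulrA -exprSr.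
Qed.

(** Moving [c] across the powers turns [(F * c%:P).[b]] into [F.[a] * c]. Conjugation by a unit is
    one instance, Peirce truncation another. *)
Lemma null_intertwine (R : finNzRingType) (F : {poly R}) (a b c : R) :
  F \in null_polys R -> c * b = a * c -> (F * c%:P).[b] = 0.
Proof.
move=> /null_polysP F0 cb; rewrite horner_mulC.
transitivity (F.[a] * c); last by rewrite F0 mul0r.
rewrite horner_coef mulr_suml.
by apply: eq_bigr => i _; rewrite (intertwine_exp _ cb) mulrA.
Qed.

(** Constants suffice for right absorption: [F * 'X] has value [F.[a] * a] at [a], so it is null
    with [F]. *)
Definition stable (R : finNzRingType) (c : R) : Prop :=
  forall F, F \in null_polys R -> F * c%:P \in null_polys R.

Lemma stableB (R : finNzRingType) (c d : R) :
  stable c -> stable d -> stable (c - d).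
Proof.
move=> Sc Sd F F0; apply/null_polysP => b.
have /null_polysP Fc := Sc F F0; have /null_polysP Fd := Sd F F0.
by rewrite polyCB mulrBr hornerD hornerN Fc Fd subrr.
Qed.

Lemma stable0 (R : finNzRingType) : stable (0 : R).
Proof. by move=> F F0; apply/null_polysP => b; rewrite mulr0 horner0. Qed.

Lemma stableD (R : finNzRingType) (c d : R) :
  stable c -> stable d -> stable (c + d).
Proof.
move=> Sc Sd; rewrite -[d]opprK; apply: stableB => //.
by rewrite -sub0r; apply: stableB => //; apply: stable0.
Qed.

Lemma stableM (R : finNzRingType) (c d : R) :
  stable c -> stable d -> stable (c * d).
Proof. by move=> Sc Sd F F0; rewrite polyCM mulrA; apply/Sd/Sc. Qed.

Lemma stable_unit (R : finNzRingType) (u v : R) : v * u = 1 -> stable u.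
Proof.
move=> vu F F0; apply/null_polysP => b.
by apply: (@null_intertwine _ _ (u * b * v)); rewrite // -mulrA vu mulr1.
Qed.

Lemma stableX (R : finNzRingType) (c : R) n : stable c -> stable (c ^+ n).
Proof.
move=> Sc; elim: n => [|n IH]; last by rewrite exprS; apply: stableM.
by apply: (@stable_unit _ _ 1); rewrite mulr1.
Qed.

(** [1 + x] is a unit with inverse [1 - x]. *)
Lemma stable_sqr0 (R : finNzRingType) (x : R) : x * x = 0 -> stable x.
Proof.
move=> xx; rewrite -[x](addrK 1); apply: stableB.
  apply: (@stable_unit _ _ (1 - x)).
  by rewrite mulrDr mulr1 mulrBl mul1r xx subr0 addrC subrK.
by apply: (@stable_unit _ _ 1); rewrite mulr1.
Qed.

(** * Reduction to idempotents *)

Lemma idempotent_power (R : finNzRingType) (x : R) :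
  exists2 n, (0 < n)%N & x ^+ n * x ^+ n = x ^+ n.
Proof.
pose h (i : 'I_#|R|.+1) := x ^+ i.
have /injectivePn[i [j neq_ij eq_h]] : ~~ injectiveb h.
  apply/negP => /injectiveP/leq_card.
  by rewrite card_ord ltnn.
have [a [k k0 ak]] : exists a, exists2 k, (0 < k)%N & x ^+ (a + k) = x ^+ a.
  case: (ltngtP i j) => [lt|lt|eq].
  - by exists i, (j - i)%N; rewrite ?subn_gt0 // subnKC ?(ltnW lt).
  - by exists j, (i - j)%N; rewrite ?subn_gt0 // subnKC ?(ltnW lt).
  - by case/eqP: neq_ij; apply: val_inj.
have shift1 m : (a <= m)%N -> x ^+ (m + k) = x ^+ m.
  by move=> le_am; rewrite -(subnK le_am) -addnA !exprD -exprD ak.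
have shift t m : (a <= m)%N -> x ^+ (m + t * k) = x ^+ m.
  elim: t m => [|t IH] m le_am; first by rewrite addn0.
  by rewrite mulSn addnA IH ?shift1 // (leq_trans le_am) ?leq_addr.
(* A multiple of the period [k] beyond the preperiod [a]; the successor keeps it positive when [a]
   is zero. *)
exists (a.+1 * k)%N; first by rewrite muln_gt0.
by rewrite -exprD shift // (leq_trans (leqnSn a)) // leq_pmulr.
Qed.

Lemma stable_idempotents (R : finNzRingType) :
  (forall g : R, g * g = g -> stable g) -> forall x : R, stable x.
Proof.
move=> Sidem x; have [[//|n] _ gg] := idempotent_power x.
set g := x ^+ n.+1 in gg.
(* With [h = 1 - g], [x = (g x + h) + (g + h (x - 1)) - g], where both brackets
   are units because [g x] is a unit of [gR] and [h x] is nilpotent. *)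
have [h hE] : {h | h = 1 - g} by exists (1 - g).
have gx : GRing.comm g x by apply/commr_sym/commrX.
have gh : g * h = 0 by rewrite hE mulrBr mulr1 gg subrr.
have hg : h * g = 0 by rewrite hE mulrBl mul1r gg subrr.
have hh : h * h = h by rewrite {2}hE mulrBr mulr1 hg subr0.
have hx : GRing.comm x h.
  by rewrite hE; apply: commrB; [apply: commr1 | apply: commr_sym].
have hS i : GRing.comm (x ^+ i) h by apply/commr_sym/commrX/commr_sym.
have gS i : GRing.comm (x ^+ i) g by apply/commr_sym/commrX.
(* As [x ^+ n.+1 = g], the inverse of [g * x] in the corner of [g] is [g * x ^+ n]. *)
have u1 : (g * x ^+ n + h) * (g * x + h) = 1.
  rewrite mulrDl !mulrDr hh (mulrA h) hg mul0r add0r.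
  rewrite -(mulrA g _ h) hS (mulrA g h) gh mul0r addr0.
  by rewrite mulrA -(mulrA g) gS (mulrA g g) gg -mulrA -exprSr gg hE addrC subrK.
(* This geometric sum satisfies [w * (1 - x) = h], so [- (h * w)] inverts [h * (x - 1)] in the
   corner of [h]. *)
pose w := \sum_(i < n.+1) x ^+ i.
have hw : GRing.comm w h.
  by apply: commr_sym; apply: commr_sum => i _; apply: commr_sym.
have gw : GRing.comm w g.
  by apply: commr_sym; apply: commr_sum => i _; apply: commr_sym.
have wx : w * (1 - x) = h.
  rewrite hE /g -[1 in RHS](expr1n _ n.+1).
  rewrite subrXX_comm; last exact: commr_sym (commr1 _).
  rewrite (_ : \sum_(i < n.+1) _ = w); last first.
    by apply: eq_bigr => i _; rewrite expr1n mul1r.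
  rewrite mulrBr mulrBl mulr1 mul1r; congr (_ - _).
  by apply: commr_sym; apply: commr_sum => i _; apply: commrX.
have v1 : (g - h * w) * (g + h * (x - 1)) = 1.
  have [y yE] : {y | y = x - 1} by exists (x - 1).
  have {}wx : w * y = - h by rewrite yE -opprB mulrN wx.
  rewrite -yE mulrBl !mulrDr gg (mulrA g h) gh mul0r addr0.
  rewrite -(mulrA h w g) gw (mulrA h g) hg mul0r add0r.
  rewrite -mulrA (mulrA w h) hw -mulrA wx !mulrN hh hh.
  by rewrite opprK hE addrC subrK.
rewrite (_ : x = (g * x + h) + (g + h * (x - 1)) - g); last first.
  rewrite (addrC g) addrA addrK mulrBr mulr1 -addrA (addrC h) subrK -mulrDl.
  by rewrite hE addrC subrK mul1r.
apply: stableB (Sidem _ gg); apply: stableD.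
  exact: stable_unit u1.
exact: stable_unit v1.
Qed.

(** * Truncation along the Peirce decomposition *)

Lemma truncated_exp (R : nzRingType) (e f b : R) i :
    e * f = 0 -> f * e = 0 -> e + f = 1 ->
    (forall x y z, e * x * f * y * e * z * f = 0) ->
  e * b ^+ i * f = e * (b - f * b * e) ^+ i * f.
Proof.
move=> ef fe ef1 H; set b1 := b - _.
have split u v : u * v = u * e * v + u * f * v.
  by rewrite -mulrDl -mulrDr ef1 mulr1.
have ebe : e * b1 = e * b by rewrite mulrBr !mulrA ef !mul0r subr0.
have b1f : b1 * f = b * f by rewrite mulrBl -!mulrA ef !mulr0 subr0.
(* With the trailing [z * f], a detour through [f] has the shape killed by [H]; [e * b ^+ j * e]
   alone may change under truncation. *)
have diag j z : e * b ^+ j * e * z * f = e * b1 ^+ j * e * z * f.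
  elim: j z => [|j IH] z; first by rewrite !expr0.
  rewrite !exprSr !mulrA (split (e * b ^+ j)) (split (e * b1 ^+ j)).
  rewrite !(mulrDl _ _ e) !(mulrDl _ _ z) !(mulrDl _ _ f) !H !addr0.
  rewrite -(mulrA _ e b1) ebe mulrA.
  by have := IH (b * e * z); rewrite !mulrA.
elim: i => [|i IH]; first by rewrite !expr0.
rewrite !exprSr !mulrA -(mulrA _ b1 f) b1f mulrA.
rewrite (split (e * b ^+ i)) (split (e * b1 ^+ i)).
by rewrite !(mulrDl _ _ f) diag IH.
Qed.

(** Since [f * b1 = (f * b) * f], intertwining makes [F * f%:P] vanish at [b1], hence also
    [F * e%:P]; after right multiplication by [f], the values at [b] and [b1] agree. *)
Lemma null_offdiagonal (R : finNzRingType) (F : {poly R}) (e f b : R) :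
    F \in null_polys R -> f * f = f ->
    e * f = 0 -> f * e = 0 -> e + f = 1 ->
    (forall x y z, e * x * f * y * e * z * f = 0) ->
  (F * e%:P).[b] * f = 0.
Proof.
move=> F0 ff ef fe ef1 H; pose b1 := b - f * b * e.
have -> : (F * e%:P).[b] * f = (F * e%:P).[b1] * f.
  rewrite !horner_mulC !mulr_suml; apply: eq_bigr => i _.
  by rewrite -!mulrA !(mulrA e) (truncated_exp _ _ ef fe ef1 H).
have fb1 : f * b1 = (f * b) * f.
  by apply/eqP; rewrite mulrBr !mulrA ff subr_eq -mulrDr (addrC f) ef1 mulr1.
have -> : e = 1 - f by rewrite -ef1 addrK.
rewrite polyCB mulrBr hornerD hornerN (null_intertwine F0 fb1) mulr1.
by have /null_polysP-> := F0; rewrite subrr mul0r.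
Qed.

(** The value at [b] is split on the right by [e + f]. The [e] part reduces to the [f] part with
    roles exchanged, because [F * e%:P] and [- (F * f%:P)] have equal values. *)
Lemma stable_peirce (R : finNzRingType) (e f : R) :
    e * e = e -> f * f = f -> e * f = 0 -> f * e = 0 -> e + f = 1 ->
    (forall x y z, e * x * f * y * e * z * f = 0) ->
    (forall x y z, f * x * e * y * f * z * e = 0) ->
  stable e.
Proof.
move=> ee ff ef fe ef1 He Hf F F0; apply/null_polysP => b.
have fe1 : f + e = 1 by rewrite addrC.
have eE : e%:P = 1 - f%:P :> {poly R} by rewrite -(addrK f e) ef1 polyCB.
rewrite -[LHS]mulr1 -ef1 mulrDr (null_offdiagonal _ F0 ff ef fe ef1 He) addr0.
rewrite eE mulrBr mulr1 hornerD hornerN; have /null_polysP-> := F0.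
by rewrite sub0r mulNr (null_offdiagonal _ F0 ee fe ef fe1 Hf) oppr0.
Qed.

(** * Counting elements in Peirce blocks *)

Lemma nilpotent_fix (R : nzRingType) (t u : R) n :
  t ^+ n = 0 -> t * u = u -> u = 0.
Proof.
move=> tn tu; rewrite -[u]mul1r -[RHS](mul0r u) -tn.
by elim: n {tn} => [|n IH]; rewrite ?expr0 // exprSr -mulrA tu.
Qed.

(** A coincidence among [0], [u], [t * u], [u + t * u] forces [u = 0], [t * u = 0] or [t * u] equal
    to [u] or [- u]; nilpotency excludes the last two. *)
Lemma nilpotent_span_inj (R : nzRingType) (t u : R) n :
    t ^+ n = 0 -> t * u != 0 ->
  injective (fun a : bool * bool => u *+ a.1 + t * u *+ a.2).
Proof.
move=> tn tu0.
have u0 : u != 0 by apply: contraNneq tu0 => ->; rewrite mulr0.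
have utu : u != t * u by apply: contraNneq u0 => /esym/(nilpotent_fix tn)->.
have uptu : u + t * u != 0.
  rewrite addr_eq0; apply: contraNneq u0 => utN.
  apply/eqP/(@nilpotent_fix _ (- t) _ n); first by rewrite exprNn tn mulr0.
  by rewrite mulNr -utN.
move: u0 tu0 utu uptu => /eqP u0 /eqP w0 /eqP uw /eqP upw; 
set w := t * u in w0 uw upw *.
have uwu : u + w <> u by move=> E; apply: w0; apply: (addrI u); rewrite addr0.
have uww : u + w <> w by move=> E; apply: u0; apply: (addIr w); rewrite add0r.
by move=> [[] []] [[] []] //=; rewrite ?mulr1n ?mulr0n ?addr0 ?add0r => E;
   have E' := esym E.
Qed.

Lemma exp_swap (R : nzRingType) (y z : R) n :
  (y * z) ^+ n.+1 = y * (z * y) ^+ n * z.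
Proof.
elim: n => [|n IH]; first by rewrite expr0 mulr1 expr1.
by rewrite exprSr IH [in RHS]exprSr !mulrA.
Qed.

Lemma card_peirce (R : finNzRingType) (e f x y z : R) m n :
    e * e = e -> f * f = f -> e * f = 0 -> f * e = 0 ->
    (e * x * f * y * e) ^+ m = 0 -> (f * y * e * z * f) ^+ n = 0 ->
    e * x * f * y * e * z * f != 0 ->
  (128 <= #|R|)%N.
Proof.
move=> ee ff ef fe xy_nil yz_nil xyz0.
set p := e * x * f * y * e in xy_nil xyz0.
set q := e * z * f; set s := f * y * e * z * f in yz_nil.
have eq' : e * q = q by rewrite /q !mulrA ee.
have qf : q * f = q by rewrite /q -!mulrA ff.
have pe : p * e = p by rewrite /p -!mulrA ee.
have ep : e * p = p by rewrite /p !mulrA ee.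
have sf : s * f = s by rewrite /s -!mulrA ff.
have fs : f * s = s by rewrite /s !mulrA ff.
have pqE : p * q = p * z * f by rewrite /q !mulrA pe.
pose r := f * y * e.
have r0 : r != 0.
  apply: contraNneq xyz0 => r0.
  have -> : p * z * f = e * x * r * z * f by rewrite /p /r !mulrA.
  by rewrite r0 mulr0 !mul0r.
have p0 : p * e != 0 by rewrite pe; apply: contraNneq xyz0 => ->; rewrite !mul0r.
have q0 : p * q != 0 by rewrite pqE.
have s0 : s * f != 0.
  rewrite sf; apply: contraNneq xyz0 => s0.
  have -> : p * z * f = e * x * s by rewrite /p /s !mulrA.
  by rewrite s0 mulr0.
pose span (t u : R) (a : bool * bool) := u *+ a.1 + t * u *+ a.2.
have span_inj t u k : t ^+ k = 0 -> t * u != 0 -> injective (span t u).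
  exact: nilpotent_span_inj.
have spanl c t u a : c * u = u -> c * t = t -> c * span t u a = span t u a.
  by move=> cu ct; rewrite mulrDr !mulrnAr mulrA cu ct.
have spanr c t u a : u * c = u -> span t u a * c = span t u a.
  by move=> uc; rewrite mulrDl !mulrnAl -mulrA uc.
(* Seven bits: two for each of [eRe], [eRf], [fRf] and one for [fRe]. *)
pose phi (a : bool * bool * (bool * bool) * (bool * bool) * bool) :=
  let: (((a1, a2), a3), a4) := a in
  e * span p e a1 * e + e * span p q a2 * f + f * span s f a3 * f
    + f * (r *+ a4) * e.
have phi_inj : injective phi.
  have eX (c : R) : e * (e * c) = e * c by rewrite mulrA ee.
  have fX (c : R) : f * (f * c) = f * c by rewrite mulrA ff.
  have efX (c : R) : e * (f * c) = 0 by rewrite mulrA ef mul0r.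
  have feX (c : R) : f * (e * c) = 0 by rewrite mulrA fe mul0r.
  move=> [[[a1 a2] a3] a4] [[[b1 b2] b3] b4] eq_phi.
  have proj c d : c * phi (a1, a2, a3, a4) * d = c * phi (b1, b2, b3, b4) * d.
    by rewrite eq_phi.
  have := proj e e; have := proj e f; have := proj f f; have := proj f e.
  (* Compressing by a pair of idempotents isolates one block, so injectivity is checked
     blockwise. *)
  have blocks A B C D : let X := e * A * e + e * B * f + f * C * f + f * D * e in
      [/\ e * X * e = e * A * e, e * X * f = e * B * f,
          f * X * f = f * C * f & f * X * e = f * D * e].
    rewrite /= !mulrDr !mulrDl -!mulrA !(eX, fX, efX, feX, ee, ff, ef, fe).
    by rewrite !(mulr0, mul0r, addr0, add0r).
  have [-> -> -> ->] :=
    blocks (span p e a1) (span p q a2) (span s f a3) (r *+ a4).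
  have [-> -> -> ->] :=
    blocks (span p e b1) (span p q b2) (span s f b3) (r *+ b4).
  rewrite !(spanl e) ?(spanl f) // !(spanr e) // !(spanr f) //.
  move=> E4 /(span_inj _ _ _ yz_nil s0)-> /(span_inj _ _ _ xy_nil q0)->.
  move=> /(span_inj _ _ _ xy_nil p0)->; congr (_, _).
  have fr c : f * (r *+ c) * e = r *+ c.
    by rewrite mulrnAr mulrnAl /r !mulrA ff -!mulrA ee.
  move/eqP: r0 => r0; move: E4; rewrite !fr.
  by case: a4 b4 {proj eq_phi} => [] [] //=; rewrite mulr1n mulr0n => E;
    case: r0.
have := leq_card _ phi_inj.
by rewrite !card_prod card_bool.
Qed.

(** * Stability of idempotents in small rings *)

Lemma stable_idempotent (R : finNzRingType) (e : R) :
  (#|R| < 128)%N -> e * e = e -> stable e.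
Proof.
move=> small.
(* Induction on the size of the right ideal [eR]. *)
have [n] := ubnP #|[set e * c | c : R]|; elim: n e => // n IH e ltn ee.
have [f fE] : {f | f = 1 - e} by exists (1 - e).
have ef : e * f = 0 by rewrite fE mulrBr mulr1 ee subrr.
have fe : f * e = 0 by rewrite fE mulrBl mul1r ee subrr.
have ff : f * f = f by rewrite {2}fE mulrBr mulr1 fe subr0.
have ef1 : e + f = 1 by rewrite fE addrC subrK.
have nil x y : stable e \/ exists k, (e * x * f * y * e) ^+ k = 0.
  set w := e * x * f * y * e.
  have [[//|k] _ gg] := idempotent_power w; set g := w ^+ k.+1 in gg.
  have [g0|g0] := eqVneq g 0; [by right; exists k.+1 | left].
  have eg : e * g = g by rewrite /g exprS mulrA /w !mulrA ee.
  have ge : g * e = g by rewrite /g exprSr -mulrA /w -!mulrA ee.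
  (* [w] is the product of [e * x * f] and [f * y * e], both of square zero. *)
  have Sg : stable g.
    apply: stableX; rewrite /w -ff !mulrA -mulrA -mulrA (mulrA f).
    by apply: stableM; apply: stable_sqr0;
       rewrite -!mulrA ?(mulrA f e) ?fe ?(mulrA e f) ?ef !(mul0r, mulr0).
  rewrite -(subrK g e); apply: stableD => //; apply: IH; last first.
    by rewrite mulrBl !mulrBr ee eg ge gg subrr subr0.
  (* [e] is not in [(e - g)R], since [g * (e - g) = 0] while [g * e = g] is nonzero. *)
  rewrite -ltnS (leq_trans _ ltn) // ltnS; apply: proper_card.
  apply/properP; split.
    apply/subsetP => _ /imsetP[c _ ->]; apply/imsetP; exists ((e - g) * c) => //.
    by rewrite mulrA mulrBr ee eg.
  exists e; first by apply/imsetP; exists 1; rewrite ?mulr1.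
  apply/imsetP => -[c _ ec]; case/eqP: g0.
  by rewrite -ge ec mulrA mulrBr ge gg subrr mul0r.
(* [nil] gives nilpotency in the corner of [e] only; a cyclic shift carries it to the corner of [f]
   at the cost of one exponent. *)
have swap x y (u v : R) k : u * u = u -> (u * x * v * y * u) ^+ k = 0 ->
    v * v = v -> (v * y * u * x * v) ^+ k.+1 = 0.
  move=> uu nilk vv; have := exp_swap (v * y * u) (u * x * v) k.
  have -> : v * y * u * (u * x * v) = v * y * u * x * v.
    by rewrite !mulrA -(mulrA _ u u) uu.
  have -> : u * x * v * (v * y * u) = u * x * v * y * u.
    by rewrite !mulrA -(mulrA _ v v) vv.
  by rewrite nilk mulr0 mul0r.
have [He|] := boolP [forall x, forall y, forall z, e * x * f * y * e * z * f == 0];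
  last first.
  case/forallPn => x /forallPn[y /forallPn[z xyz]].
  have [//|[k xy]] := nil x y; have [//|[l zy]] := nil z y.
  have := card_peirce ee ff ef fe xy (swap _ _ _ _ _ ee zy ff) xyz.
  by rewrite leqNgt small.
have [Hf|] := boolP [forall x, forall y, forall z, f * x * e * y * f * z * e == 0];
  last first.
  case/forallPn => x /forallPn[y /forallPn[z xyz]].
  have [//|[k yx]] := nil y x; have [//|[l yz]] := nil y z.
  have := card_peirce ff ee fe ef (swap _ _ _ _ _ ee yx ff) yz xyz.
  by rewrite leqNgt small.
apply: (stable_peirce ee ff ef fe ef1) => x y z; apply/eqP.
  by move/forallP: He => /(_ x)/forallP/(_ y)/forallP/(_ z).
by move/forallP: Hf => /(_ x)/forallP/(_ y)/forallP/(_ z).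
Qed.

(** * Absorption on both sides *)

Lemma null_polys_zmod (R : finNzRingType) : zmod_closed (null_polys R).
Proof.
split=> [|F G /null_polysP F0 /null_polysP G0]; apply/null_polysP => a.
  by rewrite horner0.
by rewrite hornerD hornerN F0 G0 subrr.
Qed.

Lemma null_polysMl (R : finNzRingType) (P F : {poly R}) :
  F \in null_polys R -> P * F \in null_polys R.
Proof.
elim/poly_ind: P F => [|P c IH] F /null_polysP F0.
  by apply/null_polysP => a; rewrite mul0r horner0.
apply/null_polysP => a.
rewrite mulrDl hornerD -mulrA -commr_polyX hornerCM F0 mulr0 addr0.
apply/null_polysP: a; apply: IH; apply/null_polysP => a.
by rewrite hornerMX F0 mul0r.
Qed.

Lemma null_polysMr (R : finNzRingType) (F P : {poly R}) :
    (forall c : R, stable c) ->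
  F \in null_polys R -> F * P \in null_polys R.
Proof.
move=> S F0; elim/poly_ind: P => [|P c /null_polysP IH]; apply/null_polysP => a.
  by rewrite mulr0 horner0.
have /null_polysP Fc := S c F F0.
by rewrite mulrDr mulrA hornerD hornerMX IH mul0r Fc addr0.
Qed.

Theorem theorem5p1 (R : finNzRingType)
    (not_ideal : ~ two_sided_ideal (null_polys R)) :
  (128 <= #|R|)%N.
Proof.
rewrite leqNgt; apply/negP => small; apply: not_ideal; split.
- exact: null_polys_zmod.
- by move=> P F; apply: null_polysMl.
- move=> P F; apply: null_polysMr; apply: stable_idempotents => g.
  exact: stable_idempotent.
Qed.
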